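(* Let $n\ge1$ be an integer, $L>0$, $r>0$, $\gamma\ge 0$, let $W\in\mathbb{R}^{n\times n}$ be a given weighting matrix, and let $Q_2\in\mathbb{R}^{n\times n}$ be symmetric with $Q_2\mathbf{1}=0$ and $\zeta^TQ_2\zeta>0$ for all $\zeta\ne0$ with $\zeta^T\mathbf{1}=0$. Put $$A=\begin{bmatrix} 0 & I \\ -\tfrac{1}{L} I & 0 \end{bmatrix},\quad B=\begin{bmatrix} 0 \\ I \end{bmatrix},\quad C=\begin{bmatrix} 0 & I \end{bmatrix},\quad Q=\begin{bmatrix} 0 & 0 \\ 0 & Q_2 \end{bmatrix},\quad R=rI,$$ with $n\times n$ blocks. Then the optimization problem, in the variables $K\in\mathbb{R}^{n\times n}$ and $P\in\mathbb{R}^{2n\times 2n}$, $$\begin{array}{ll} \text{minimize} & \operatorname{trace}(PBB^T)+\gamma\,\|W\circ K\|_{\ell_1} \\ \text{subject to} & (A-BKC)^TP+P(A-BKC)=-(Q+C^TK^TRKC), \\ & K\in\mathcal{L},\quad P\succeq0, \end{array}\qquad(\mathrm{I})$$ is equivalent to the semidefinite program $$\begin{array}{ll} \text{minimize} & \tfrac12\operatorname{trace}(X+rK)+\gamma\,\operatorname{trace}(\mathbf{1}\mathbf{1}^TY) \\ \text{subject to} & \begin{bmatrix} X & Q_2^{1/2} \\ Q_2^{1/2} & K+\mathbf{1}\mathbf{1}^T/n \end{bmatrix}\succeq0, \\ & M\circ K\le0,\quad K\mathbf{1}=0,\quad -Y\le W\circ K\le Y, \end{array}\qquad(\mathrm{II})$$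 where the optimization variables of (II) are the symmetric $n\times n$ matrices $K$ and $X$ and the elementwise-nonnegative $n\times n$ matrix $Y$, and $M:=\mathbf{1}\mathbf{1}^T-I$. Here equivalence means that a matrix $K$ is the $K$-component of an optimal solution $(K,P)$ of (I) if and only if it is the $K$-component of an optimal solution $(K,X,Y)$ of (II).
   Context: $\mathbf{1}\in\mathbb{R}^n$ is the column vector of all ones. The set of weighted Laplacians of connected graphs is $$\mathcal{L}:=\{K\in\mathbb{R}^{n\times n}\mid K=K^T,\ K\mathbf{1}=0,\ K+\mathbf{1}\mathbf{1}^T/n\succ0,\ K_{ij}\le0\text{ for }i\ne j\}.$$ $\succeq,\succ$ denote inequalities in the semidefinite sense for symmetric matrices ($P\succeq 0$ includes symmetry of $P$); $\le$ between matrices is elementwise; $\circ$ is the elementwise (Hadamard) product; $\|K\|_{\ell_1}=\sum_{i,j}|K_{ij}|$; $I$ is the $n\times n$ identity matrix; $Q_2^{1/2}$ is the positive semidefinite square root of $Q_2$. The assumption that the lower-left block of $A$ is $-\tfrac{1}{L} I$ (all inductors equal to $L$) is called the uniform inductance assumption. *)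

(* Defs.v *)
From mathcomp Require Import all_boot all_order all_algebra.
From mathcomp Require Import all_classical all_reals.

Set Implicit Arguments.
Unset Strict Implicit.
Unset Printing Implicit Defensive.

Import Order.TTheory GRing.Theory Num.Theory.

Local Open Scope classical_set_scope.
Local Open Scope ring_scope.

(* Attained minimum of f over S; nothing is asserted about existence. *)
Definition minimizer (R : realType) (T : Type) (S : set T) (f : T -> R)
    (x : T) : Prop :=
  S x /\ forall y, S y -> f x <= f y.

Section Matrices.
Context {R : realType}.

Definition ones {n : nat} : 'cV[R]_n := const_mx 1.

Definition qform (n : nat) (A : 'M[R]_n) (x : 'cV[R]_n) : R :=
  (x^T *m A *m x) 0 0.

Definition psdmx (n : nat) (A : 'M[R]_n) : Prop :=
  A^T = A /\ forall x : 'cV[R]_n, 0 <= qform A x.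

Definition pdmx (n : nat) (A : 'M[R]_n) : Prop :=
  A^T = A /\ forall x : 'cV[R]_n, x != 0 -> 0 < qform A x.

(* The psd square root. It exists and is unique when A is psd, so the default
   value 0 of xget is irrelevant there. *)
Definition psd_sqrt (n : nat) (A : 'M[R]_n) : 'M[R]_n :=
  xget 0 [set S : 'M[R]_n | psdmx S /\ S *m S = A].

Definition hadamard (m n : nat) (A B : 'M[R]_(m, n)) : 'M[R]_(m, n) :=
  map2_mx *%R A B.

Definition mx_le (m n : nat) (A B : 'M[R]_(m, n)) : Prop :=
  forall i j, A i j <= B i j.

(* The entrywise l1 norm, not the operator norm. *)
Definition l1norm (m n : nat) (A : 'M[R]_(m, n)) : R :=
  \sum_i \sum_j `|A i j|.

Definition laplacians (n : nat) : set 'M[R]_n :=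
  [set K | [/\ K = K^T,
               K *m ones = 0 :> 'cV[R]_n,
               pdmx (K + n%:R^-1 *: (ones *m ones^T)) &
               forall i j, i != j -> K i j <= 0]].

Section ProblemI.
Variables (N n : nat) (A : 'M[R]_N) (B : 'M[R]_(N, n)) (C : 'M[R]_(n, N)).
Variables (Q : 'M[R]_N) (Rm : 'M[R]_n) (gamma : R) (W : 'M[R]_n).

Definition feasibleI : set ('M[R]_n * 'M[R]_N) :=
  [set KP | let: (K, P) := KP in
    [/\ (A - B *m K *m C)^T *m P + P *m (A - B *m K *m C)
          = - (Q + C^T *m K^T *m Rm *m K *m C),
        laplacians K & psdmx P]].

Definition costI (KP : 'M[R]_n * 'M[R]_N) : R :=
  let: (K, P) := KP in
  \tr (P *m B *m B^T) + gamma * l1norm (hadamard W K).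

End ProblemI.

Section ProblemII.
Variables (n : nat) (Q2 : 'M[R]_n) (r gamma : R) (W : 'M[R]_n).

Definition feasibleII : set ('M[R]_n * 'M[R]_n * 'M[R]_n) :=
  [set KXY | let: (K, X, Y) := KXY in
    let M : 'M[R]_n := ones *m ones^T - 1%:M in
    [/\ K^T = K, X^T = X & mx_le 0 Y] /\
    [/\ psdmx (block_mx X (psd_sqrt Q2)
                 (psd_sqrt Q2) (K + n%:R^-1 *: (ones *m ones^T))),
        mx_le (hadamard M K) 0,
        K *m ones = 0 :> 'cV[R]_n,
        mx_le (- Y) (hadamard W K) &
        mx_le (hadamard W K) Y]].

Definition costII (KXY : 'M[R]_n * 'M[R]_n * 'M[R]_n) : R :=
  let: (K, X, Y) := KXY in
  2^-1 * \tr (X + r *: K) + gamma * \tr (ones *m ones^T *m Y).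

End ProblemII.

End Matrices.

(* Main.v *)
Require Import Defs.
From HB Require Import structures.
From mathcomp Require Import all_boot all_order all_algebra.
From mathcomp Require Import all_classical all_reals.
From mathcomp Require Import ring lra.
From mathcomp Require Import complex.

(** Both problems are partial minimizations over the same set of Laplacians [K]
of the same function (with [J = 11^T/n] and [G = K + J])
  [f K = (tr (G^-1 Q2) + r tr K) / 2 + gamma |W o K|].
In (I), the block equations of the Lyapunov equation reduce to
[K P2 + P2 K = Q2 + r K^2]; multiplying by [G^-1] and taking traces determines
[tr P2] up to the term [1^T P2 1 / n >= 0], which vanishes for the psd solution
[P2] of the Lyapunov equation with [G] in place of [K].  In (II), the block
constraint forces [G] to be definite and a Schur complement bounds [tr X] below
by [tr (G^-1 Q2)]. *)

Set Implicit Arguments.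
Unset Strict Implicit.
Unset Printing Implicit Defensive.

Import Order.TTheory GRing.Theory Num.Theory.

Local Open Scope ring_scope.

(** * Quadratic forms and semidefinite matrices *)

Section QuadraticForms.
Variable R : realType.
Implicit Types m n : nat.

Lemma mx11_tr (a : 'M[R]_1) : a^T = a.
Proof. by apply/matrixP => i j; rewrite mxE !ord1. Qed.

Lemma mxD m n (A B : 'M[R]_(m, n)) i j : (A + B) i j = A i j + B i j.
Proof. by rewrite mxE. Qed.

Lemma mxZ m n a (A : 'M[R]_(m, n)) i j : (a *: A) i j = a * A i j.
Proof. by rewrite mxE. Qed.

Lemma qform0r n (A : 'M[R]_n) : qform A 0 = 0.
Proof. by rewrite /qform mulmx0 mxE. Qed.

Lemma qformDl n (A B : 'M[R]_n) x : qform (A + B) x = qform A x + qform B x.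
Proof. by rewrite /qform mulmxDr mulmxDl mxE. Qed.

Lemma qformZl n a (A : 'M[R]_n) x : qform (a *: A) x = a * qform A x.
Proof. by rewrite /qform -scalemxAr -scalemxAl mxE. Qed.

Lemma qformD n (A : 'M[R]_n) x y t : A^T = A ->
  qform A (x + t *: y) =
  qform A x + t * (y^T *m (A *m x)) 0 0 *+ 2 + t ^+ 2 * qform A y.
Proof.
move=> sA; have tE : (x + t *: y)^T = x^T + t *: y^T.
  by apply/matrixP => i j; rewrite !mxE.
rewrite /qform tE !mulmxDl !mulmxDr.
rewrite -!scalemxAl -!scalemxAr !mxD !mxZ.
have -> : (x^T *m A *m y) 0 0 = (y^T *m (A *m x)) 0 0.
  by rewrite -[x^T *m A *m y]mx11_tr !trmx_mul trmxK sA.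
rewrite -!mulmxA; ring.
Qed.

Lemma qform_mul m n (A : 'M[R]_n) (M : 'M[R]_(n, m)) x :
  qform A (M *m x) = qform (M^T *m A *m M) x.
Proof. by rewrite /qform trmx_mul !mulmxA. Qed.

Lemma dot_ge0 n (x : 'cV[R]_n) : 0 <= (x^T *m x) 0 0.
Proof. by rewrite mxE sumr_ge0// => i _; rewrite mxE -expr2 sqr_ge0. Qed.

Lemma dot_eq0 n (x : 'cV[R]_n) : (x^T *m x) 0 0 = 0 -> x = 0.
Proof.
have nn (j : 'I_n) : true -> 0 <= x^T 0 j * x j 0.
  by rewrite mxE -expr2 sqr_ge0.
rewrite mxE => /(psumr_eq0P nn) h; apply/colP => i.
by have := h i isT; rewrite !mxE -expr2 => /eqP; rewrite sqrf_eq0 => /eqP.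
Qed.

(* [-s / c] minimizes the quadratic in [t]; the [+ 1] avoids [c = 0]. *)
Lemma descent_eq0 (s c : R) (t := - (s / (c + 1))) : 0 <= s -> 0 <= c ->
  0 <= t * s *+ 2 + t ^+ 2 * c -> s = 0.
Proof.
move=> s0 c0; have c1 : 0 < c + 1 by lra.
have -> : t * s *+ 2 + t ^+ 2 * c = - (s ^+ 2 * (c + 2)) / (c + 1) ^+ 2.
  by rewrite /t; field; lra.
rewrite pmulr_lge0 ?invr_gt0 ?exprn_gt0// oppr_ge0 pmulr_lle0; last by lra.
by move=> h; apply/eqP; rewrite -sqrf_eq0 eq_le h sqr_ge0.
Qed.

(** Along the line [x + t *: (A *m x)] the form is a quadratic in [t] with no constant term and
    linear coefficient twice the squared norm of [A *m x]; staying nonnegative forces that norm to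
    vanish. *)
Lemma psd_ker n (A : 'M[R]_n) x : psdmx A -> qform A x = 0 -> A *m x = 0.
Proof.
move=> [sA pA] qx; apply: dot_eq0; set y := A *m x.
set s := (y^T *m y) 0 0; set c := qform A y.
have s0 : 0 <= s by exact: dot_ge0.
have c0 : 0 <= c by exact: pA.
have := pA (x + (- (s / (c + 1))) *: y).
rewrite qformD// qx -/y -/s -/c add0r => h.
exact: descent_eq0 s0 c0 h.
Qed.

Lemma pd_psd n (A : 'M[R]_n) : pdmx A -> psdmx A.
Proof.
move=> [sA pA]; split=> // x; have [->|x0] := eqVneq x 0; last exact/ltW/pA.
by rewrite qform0r.
Qed.

Lemma psd_pd n (A : 'M[R]_n) :
  psdmx A -> (forall x : 'cV[R]_n, A *m x = 0 -> x = 0) -> pdmx A.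
Proof.
move=> pA kA; split=> [|x x0]; first exact: pA.1.
rewrite lt_neqAle pA.2 andbT eq_sym; apply: contraNneq x0 => q0.
by apply/eqP/kA/psd_ker.
Qed.

Lemma pd_unit n (A : 'M[R]_n) : pdmx A -> A \in unitmx.
Proof.
move=> [sA pA]; rewrite -row_free_unit -kermx_eq0; apply/eqP/row_matrixP => i.
rewrite row0; have /(congr1 (row i)) := mulmx_ker A.
rewrite row_mul row0; move: (row i _) => v vA.
apply/eqP/negPn/negP => v0.
have /pA : v^T != 0 by rewrite -[0]trmx0 (inj_eq trmx_inj).
by rewrite /qform trmxK vA mul0mx mxE ltxx.
Qed.

(** This turns (semi)definiteness into trace inequalities, both for uniqueness in the Lyapunov
    equation and for the Schur complement bound. *)
Lemma mxtrace_qform m n (A : 'M[R]_n) (M : 'M[R]_(n, m)) :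
  \tr (M^T *m A *m M) = \sum_i qform A (col i M).
Proof.
apply: eq_bigr => i _; rewrite /qform tr_col -row_mul [LHS]mxE [RHS]mxE.
by apply: eq_bigr => k _; rewrite [row _ _ _ _]mxE [col _ _ _ _]mxE.
Qed.

Lemma psd_congr m n (A : 'M[R]_n) (M : 'M[R]_(n, m)) :
  psdmx A -> psdmx (M^T *m A *m M).
Proof.
move=> [sA pA]; split=> [|x]; last by rewrite -qform_mul.
by rewrite !trmx_mul trmxK sA mulmxA.
Qed.

Lemma psd_sqr n (S : 'M[R]_n) : S^T = S -> psdmx (S *m S).
Proof.
move=> sS; rewrite -{1}sS -[S^T]mulmx1; apply: psd_congr.
by split=> [|x]; rewrite ?trmx1// /qform mulmx1 dot_ge0.
Qed.

Lemma psd_block_diag m n (A : 'M[R]_m) (B : 'M[R]_n) :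
  psdmx A -> psdmx B -> psdmx (block_mx A 0 0 B).
Proof.
move=> [sA pA] [sB pB]; split; first by rewrite tr_block_mx !trmx0 sA sB.
move=> x; rewrite -[x]vsubmxK /qform tr_col_mx mul_row_block !mulmx0 addr0.
by rewrite add0r mul_row_col mxE addr_ge0//; [exact: pA|exact: pB].
Qed.

Lemma psd_block_dr m n (A : 'M[R]_m) B C (D : 'M[R]_n) :
  psdmx (block_mx A B C D) -> psdmx D.
Proof.
move=> [sA pA]; split.
  by move: sA; rewrite tr_block_mx => /eq_block_mx[].
move=> x; have := pA (col_mx 0 x).
rewrite /qform tr_col_mx mul_row_block trmx0 !mul0mx !add0r mul_row_col.
by rewrite mulmx0 add0r.
Qed.

Lemma interpolation (s : seq R) (f : R -> R) :
  exists p : {poly R}, forall x, x \in s -> p.[x] = f x.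
Proof.
elim: s => [|a s [p pP]]; first by exists 0.
have [as_|as_] := boolP (a \in s).
  by exists p => x; rewrite inE => /orP[/eqP->|]; apply: pP.
pose q := \prod_(b <- s) ('X - b%:P).
have qa : q.[a] != 0 by rewrite -/(root q a) root_prod_XsubC.
(* Newton's step: [q] vanishes on [s], so the correction at [a] leaves the earlier values
   unchanged. *)
exists (p + ((f a - p.[a]) / q.[a])%:P * q) => x.
rewrite !hornerE inE => /orP[/eqP->|xs]; first by field.
have /rootP -> : root q x by rewrite root_prod_XsubC.
by rewrite mulr0 addr0 pP.
Qed.

End QuadraticForms.

(** * Real spectral calculus and the psd square root *)

Section SquareRoot.
Variable R : realType.
Implicit Types n : nat.

(** Over the complex numbers [A] is hermitian, hence unitarily diagonalizable with real diagonal,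
    and [s] lists that diagonal. The second property stands in for a real diagonalization: a
    polynomial in [A] is controlled by its values on [s]. *)
Lemma sym_real_spectrum n (A : 'M[R]_n.+1) : A^T = A ->
  exists2 s : seq R, {in s, forall a, eigenvalue A a} &
    forall p : {poly R}, {in s, forall a, p.[a] = 0} -> horner_mx A p = 0.
Proof.
move=> sA; pose toC : {rmorphism R -> complex R} := real_complex R.
pose Ac := map_mx toC A.
have hA : Ac \is hermsymmx.
  apply: realsym_hermsym.
    by apply/is_hermitianmxP; rewrite expr0 scale1r map_mx_id// map_trmx sA.
  by apply/mxOverP => i j; rewrite mxE; apply/complex_realP; exists (A i j).
have /orthomx_spectralP eA := hermitian_normalmx hA.
have /mxOverP dR := hermitian_spectral_diag_real hA.
have uS := spectral_unit Ac.
set S := spectralmx Ac in eA uS; set d := spectral_diag Ac in eA dR.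
have /choice[e eE] : forall i, exists a : R, d 0 i = toC a.
  by move=> i; have /complex_realP[a ->] := dR 0 i; exists a.
exists [seq e i | i <- enum 'I_n.+1].
  (* The eigenvector at hand, a row of [S], is complex; the eigenvalue descends to the reals as a
     root of the characteristic polynomial. *)
  move=> _ /mapP[i _ ->]; rewrite eigenvalue_root_char -(fmorph_root toC).
  rewrite map_char_poly -eigenvalue_root_char -/Ac -eE.
  apply/eigenvalueP; exists (row i S).
    rewrite {1}eA !mulmxA -!row_mul mulmxV// mul1mx row_mul row_diag_mx.
    by rewrite -scalemxAl rowE.
  apply: contraTneq uS => Si; rewrite -row_free_unit -kermx_eq0.
  apply/negP => /eqP kS.
  have : delta_mx 0 i *m S = 0 :> 'rV_ _ by rewrite -rowE.
  move=> /sub_kermxP; rewrite kS submx0 => /eqP/rowP/(_ i)/eqP.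
  by rewrite !mxE !eqxx oner_eq0.
move=> p pe; apply: (map_mx_inj (f := toC)).
rewrite map_mx0 map_horner_mx -/Ac eA.
rewrite horner_mx_uconjC// horner_mx_diag.
suff -> : map_mx (horner (map_poly toC p)) d = 0.
  by rewrite linear0 mulmx0 mul0mx.
apply/rowP => i; rewrite !mxE eE horner_map pe ?rmorph0//.
by apply: map_f; rewrite mem_enum.
Qed.

(* With [p] interpolating the fourth root on the spectrum, [p(A)^2] is a square
root of [A] that is real, and psd because it is the square of a symmetric
matrix. *)
Lemma sym_sqrt n (A : 'M[R]_n) : A^T = A ->
  (forall a, eigenvalue A a -> 0 <= a) ->
  exists2 S : 'M[R]_n, psdmx S & S *m S = A.
Proof.
(* Polynomials in a matrix are formed in positive size only, so size 0 is treated apart. *)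
case: n A => [|n] A sA eA.
  exists 0; last by rewrite !thinmx0.
  split=> [|x]; first by rewrite trmx0.
  by rewrite /qform mulmx0 mul0mx mxE.
have [s sP s0] := sym_real_spectrum sA.
have [p pP] := interpolation s (fun a => Num.sqrt (Num.sqrt a)).
pose T := horner_mx A p.
have sT : T^T = T.
  rewrite /T; elim/poly_ind: (p) => [|q c IH]; first by rewrite rmorph0 trmx0.
  rewrite rmorphD rmorphM /= horner_mx_X horner_mx_C.
  rewrite [LHS]raddfD /= tr_scalar_mx trmx_mul IH sA; congr (_ + _).
  exact: (comm_mx_horner q (erefl (A *m A))).
have T4 : T *m T *m (T *m T) = A.
  apply/eqP; rewrite -subr_eq0; apply/eqP.
  transitivity (horner_mx A (p * p * (p * p) - 'X)).
    by rewrite rmorphB !rmorphM /= horner_mx_X.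
  apply: s0 => a /[dup] /sP /eA a0 /pP pa.
  rewrite hornerD hornerN !hornerM hornerX pa -!expr2.
  by rewrite !sqr_sqrtr ?sqrtr_ge0// subrr.
by exists (T *m T) => //; apply: psd_sqr.
Qed.

Lemma sym_psd n (A : 'M[R]_n) : A^T = A ->
  (forall a, eigenvalue A a -> 0 <= a) -> psdmx A.
Proof.
by move=> sA /(sym_sqrt sA)[S [sS _] <-]; apply: psd_sqr.
Qed.

Lemma psd_eigen_ge0 n (A : 'M[R]_n) a : psdmx A -> eigenvalue A a -> 0 <= a.
Proof.
move=> [sA pA] /eigenvalueP[v vA v0].
have vv : 0 < (v *m v^T) 0 0.
  have := dot_ge0 v^T; rewrite trmxK le_eqVlt => /orP[/eqP/esym h|//].
  have /dot_eq0 : (v^T^T *m v^T) 0 0 = 0 by rewrite trmxK.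
  by move=> /(congr1 trmx); rewrite trmxK trmx0 => /eqP; rewrite (negPf v0).
have := pA v^T; rewrite /qform trmxK vA -scalemxAl mxE pmulr_lge0//.
Qed.

Lemma psd_sqrtP n (A : 'M[R]_n) : psdmx A ->
  psdmx (psd_sqrt A) /\ psd_sqrt A *m psd_sqrt A = A.
Proof.
move=> pA; have [S pS SA] := sym_sqrt pA.1 (fun a => psd_eigen_ge0 pA).
apply: (@xgetPex _ 0 [set S : 'M[R]_n | psdmx S /\ S *m S = A]%classic).
by exists S.
Qed.

End SquareRoot.

(** * The Lyapunov equation with a definite coefficient *)

Section Lyapunov.
Variable R : realType.
Implicit Types n : nat.

(* Pairing the equation with [S] gives [tr (S^T G S) + tr (S G S^T) = 0]. *)
Lemma lyapunov_inj n (G S : 'M[R]_n) : pdmx G ->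
  G *m S + S *m G = 0 -> S = 0.
Proof.
move=> pG e; have [_ nG] := pd_psd pG.
have : \tr (S^T *m G *m S) + \tr (S *m G *m S^T) = 0.
  rewrite [X in _ + X]mxtrace_mulC mulmxA -mulmxA -mxtraceD.
  rewrite -[_ *m S *m G]mulmxA -mulmxDr e.
  by rewrite mulmx0 mxtrace0.
have t2 : 0 <= \tr (S *m G *m S^T).
  by rewrite -{1}[S]trmxK mxtrace_qform sumr_ge0.
have t1 : 0 <= \tr (S^T *m G *m S) by rewrite mxtrace_qform sumr_ge0.
move/eqP; rewrite paddr_eq0// mxtrace_qform => /andP[/eqP h _].
apply/matrixP => i j.
have nn (k : 'I_n) : true -> 0 <= qform G (col k S) by [].
have q0 : qform G (col j S) = 0 := psumr_eq0P nn h isT.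
move: pG => [_ pG].
have [/colP/(_ i)|/pG] := eqVneq (col j S) 0; first by rewrite !mxE.
by rewrite q0 ltxx.
Qed.

(** The Lyapunov operator is an injective endomorphism of a finite-dimensional space, hence onto;
    [lin_mx] provides its matrix, which is then inverted. *)
Lemma lyapunov_sol n (G F : 'M[R]_n) : pdmx G -> exists S, G *m S + S *m G = F.
Proof.
move=> pG; pose f (S : 'M[R]_n) := G *m S + S *m G.
have lf : linear f.
  move=> a u v; rewrite /f mulmxDr mulmxDl -scalemxAl -scalemxAr scalerDr.
  by rewrite addrACA.
pose fL := GRing.isLinear.Build R _ _ _ f lf.
pose g : {linear 'M[R]_n -> 'M[R]_n} := HB.pack f fL.
have gu : lin_mx g \in unitmx.
  rewrite -row_free_unit -kermx_eq0; apply/eqP/row_matrixP => i.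
  have /(congr1 (row i)) := mulmx_ker (lin_mx g).
  rewrite row_mul !row0; move: (row i _) => v vg.
  apply: (can_inj vec_mxK); rewrite linear0; apply: (lyapunov_inj pG).
  by have := congr1 vec_mx vg; rewrite mul_rV_lin mxvecK linear0.
exists (vec_mx (mxvec F *m invmx (lin_mx g))).
have := mul_vec_lin g (vec_mx (mxvec F *m invmx (lin_mx g))).
rewrite vec_mxK mulmxKV// => /(congr1 vec_mx).
rewrite !mxvecK /= => h; exact: esym h.
Qed.

(** [S^T - S] solves the homogeneous equation, so [S] is symmetric. If [v *m S = a *: v], evaluating
    [F] at [v] gives [2 a] times the positive value of [G] at [v], so [a] is nonnegative. *)
Lemma lyapunov_psd n (G F : 'M[R]_n) : pdmx G -> psdmx F ->
  exists2 S, psdmx S & G *m S + S *m G = F.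
Proof.
move=> pG [sF pF]; have [S SF] := lyapunov_sol F pG; exists S => //.
have [sG qG] := pG; have sS : S^T = S.
  apply/eqP; rewrite -subr_eq0; apply/eqP; apply: (lyapunov_inj pG).
  rewrite mulmxBr mulmxBl addrACA -opprD SF.
  have := congr1 trmx SF; rewrite raddfD /= !trmx_mul sG sF => h.
  by rewrite (addrC (G *m _)) h subrr.
apply: sym_psd => // a /eigenvalueP[v vS v0]; have := pF v^T.
have : 0 < qform G v^T by apply: qG; rewrite -trmx0 (inj_eq trmx_inj).
rewrite -SF /qform trmxK.
have -> : v *m (G *m S + S *m G) *m v^T = (a *: (v *m G *m v^T)) *+ 2.
  rewrite mulmxDr mulmxDl !mulmxA vS -!scalemxAl mulr2n; congr (_ + _).
  by rewrite -!mulmxA -{1}sS -trmx_mul vS linearZ /= -!scalemxAr.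
rewrite mulr2n mxD mxZ -mulrDl => gp.
by rewrite pmulr_lge0// -mulr2n pmulrn_lge0.
Qed.

End Lyapunov.

(** Partial minimization: the hypotheses say that [g] is the attained minimum of [c] on each fibre
    of [pr] over [D]. It is applied once to each problem, with [pr] extracting [K]. *)
Lemma minimizer_proj (R : realType) (T U : Type) (pr : U -> T)
    (S : set U) (c : U -> R) (D : set T) (g : T -> R) :
  (forall u, S u -> D (pr u) /\ g (pr u) <= c u) ->
  (forall x, D x -> exists u, [/\ S u, pr u = x & c u = g x]) ->
  forall x, (exists2 u, pr u = x & minimizer S c u) <-> minimizer D g x.
Proof.
move=> lb att x; split=> [[u <- [Su mu]]|[Dx mx]].
  have [Du gu] := lb _ Su; split=> // y /att[v [Sv _ <-]].
  exact: le_trans gu (mu v Sv).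
have [u [Su ux cu]] := att _ Dx; exists u => //; split=> // v Sv.
have [Dv gv] := lb _ Sv; rewrite cu; exact: le_trans (mx _ Dv) gv.
Qed.

(** * Laplacians and the orthogonal projection [J] onto the line of [ones] *)

Section Laplacian.
Variables (R : realType) (n : nat).
Hypothesis n_gt0 : (0 < n)%N.
Implicit Types K P Q : 'M[R]_n.

Local Notation ones := (ones : 'cV[R]_n).
Local Notation J := (n%:R^-1 *: (ones *m ones^T)).

Lemma mxtrace_J P : \tr (J *m P) = n%:R^-1 * qform P ones.
Proof.
by rewrite -scalemxAl mxtraceZ -mulmxA mxtrace_mulC trace_mx11.
Qed.

Lemma J_ones : J *m ones = ones.
Proof.
have -> : J *m ones = n%:R^-1 *: (ones *m (ones^T *m ones)).
  by rewrite -scalemxAl mulmxA.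
have -> : ones^T *m ones = n%:R%:M.
  apply/matrixP => i j; rewrite !mxE !ord1 eqxx mulr1n.
  rewrite (eq_bigr (fun=> 1)) => [|k _]; first by rewrite sumr_const card_ord.
  by rewrite !mxE mulr1.
by rewrite mul_mx_scalar scalerA mulVf ?scale1r// pnatr_eq0 -lt0n.
Qed.

Lemma tr_J : J^T = J.
Proof. by rewrite linearZ /= trmx_mul trmxK. Qed.

Lemma ones_tr0 K : K^T = K -> K *m ones = 0 -> ones^T *m K = 0.
Proof. by move=> sK K1; rewrite -sK -trmx_mul K1 trmx0. Qed.

Variable K : 'M[R]_n.
Local Notation G := (K + J).

Lemma lapl_mulJ : K *m ones = 0 -> G *m J = J.
Proof.
move=> K1; rewrite mulmxDl -[K *m J]scalemxAr mulmxA K1 mul0mx scaler0 add0r.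
by rewrite -[LHS]scalemxAr mulmxA J_ones.
Qed.

Hypothesis LK : laplacians K.

(** Since [K] kills [ones], multiplication by [G] on either side fixes [J], and so does
    multiplication by its inverse; now write [K] as [G - J]. *)
Lemma lapl_mul_inv : (invmx G *m K = 1%:M - J) * (K *m invmx G = 1%:M - J).
Proof.
case: LK => sK K1 /pd_unit uG _.
have GJ := lapl_mulJ K1.
have JG : J *m G = J.
  by have := congr1 trmx GJ; rewrite trmx_mul raddfD /= tr_J -sK.
have iJ : invmx G *m J = J by have := mulKmx uG J; rewrite GJ.
have Ji : J *m invmx G = J by have := mulmxK uG J; rewrite JG.
split.
  by rewrite -{2}[K](addrK J) mulmxBr mulVmx// iJ.
by rewrite -{1}[K](addrK J) mulmxBl mulmxV// Ji.
Qed.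

Lemma lapl_inv_sym : (invmx G)^T = invmx G.
Proof. by case: LK => _ _ [sG _] _; rewrite trmx_inv sG. Qed.

(** After multiplication by [invmx G], cyclicity makes each left-hand term contribute
    [\tr P - \tr (J *m P)], while the quadratic term contributes [\tr K] because [J *m K] has trace
    0. *)
Lemma lapl_trace_lyapunov Q (r : R) P :
  K *m P + P *m K = Q + r *: (K *m K) ->
  \tr P = 2^-1 * (\tr (invmx G *m Q) + r * \tr K) + n%:R^-1 * qform P ones.
Proof.
move=> /(congr1 (fun X => \tr (invmx G *m X))).
rewrite 2!mulmxDr !mxtraceD -scalemxAr mxtraceZ !mulmxA.
rewrite [\tr (invmx G *m P *m K)]mxtrace_mulC mulmxA !lapl_mul_inv.
rewrite !mulmxBl !mul1mx !raddfB /= !mxtrace_J.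
have -> : qform K ones = 0.
  by case: LK => _ K1 _ _; rewrite /qform -mulmxA K1 mulmx0 mxE.
move=> h; lra.
Qed.

End Laplacian.

(** * Both problems at a fixed [K] *)

Section Problems.
Variables (R : realType) (n : nat).
Hypothesis n_gt0 : (0 < n)%N.
Variables (L r gamma : R) (W Q2 : 'M[R]_n).
Hypotheses (L_gt0 : 0 < L) (r_gt0 : 0 < r) (gamma_ge0 : 0 <= gamma).
Hypotheses (Q2_sym : Q2^T = Q2) (Q2_ones : Q2 *m ones = 0 :> 'cV[R]_n).
Hypothesis Q2_pos : forall z : 'cV[R]_n,
  z != 0 -> z^T *m ones = 0 :> 'M[R]_1 -> 0 < qform Q2 z.

Local Notation ones := (ones : 'cV[R]_n).
Local Notation J := (n%:R^-1 *: (ones *m ones^T)).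
Local Notation A := (block_mx 0 1%:M (- (L^-1 *: 1%:M)) 0 : 'M[R]_(n + n)).
Local Notation B := (col_mx 0 1%:M : 'M[R]_(n + n, n)).
Local Notation C := (row_mx 0 1%:M : 'M[R]_(n, n + n)).
Local Notation Q := (block_mx 0 0 0 Q2 : 'M[R]_(n + n)).
Local Notation Rm := (r *: 1%:M : 'M[R]_n).

(** The function [f] of the overview: the least cost at a fixed Laplacian [K], in either problem. *)
Definition profile (K : 'M[R]_n) : R :=
  2^-1 * (\tr (invmx (K + J) *m Q2) + r * \tr K)
  + gamma * l1norm (hadamard W K).

Lemma Q2J : (Q2 *m J = 0) * (J *m Q2 = 0).
Proof.
rewrite -scalemxAr -scalemxAl mulmxA Q2_ones -mulmxA ones_tr0//.
by rewrite mul0mx mulmx0 scaler0.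
Qed.

(** Centering carries the positivity hypothesis, stated on the complement of [ones], to arbitrary
    vectors. *)
Lemma qform_center x : qform Q2 (x - J *m x) = qform Q2 x.
Proof.
rewrite -{1}[x]mul1mx -mulmxBl qform_mul [(1%:M - J)^T]raddfB /= trmx1 tr_J.
by rewrite mulmxBl mul1mx mulmxBr mulmx1 Q2J subr0 Q2J subr0.
Qed.

Lemma center_orth (x : 'cV[R]_n) : (x - J *m x)^T *m ones = 0.
Proof.
by rewrite raddfB /= trmx_mul tr_J mulmxBl -mulmxA J_ones// subrr.
Qed.

Lemma Q2_ker (x : 'cV[R]_n) : qform Q2 x = 0 -> J *m x = x.
Proof.
rewrite -qform_center => qx; apply/eqP; rewrite eq_sym -subr_eq0.
by apply/negPn/negP => /Q2_pos /(_ (center_orth x)); rewrite qx ltxx.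
Qed.

Lemma Q2_psd : psdmx Q2.
Proof.
split=> // x; rewrite -qform_center.
have [->|/Q2_pos/(_ (center_orth x))/ltW//] := eqVneq (x - J *m x) 0.
by rewrite qform0r.
Qed.

Lemma closed_loop K :
  A - B *m K *m C = block_mx 0 1%:M (- (L^-1 *: 1%:M)) (- K).
Proof.
rewrite -mulmxA mul_mx_row mulmx0 mulmx1 mul_col_row !mul0mx !mulmx0 mul1mx.
by rewrite opp_block_mx add_block_mx !oppr0 !addr0 add0r.
Qed.

Lemma lyapunov_rhs K : - (Q + C^T *m K^T *m Rm *m K *m C) =
  block_mx 0 0 0 (- (Q2 + r *: (K^T *m K))).
Proof.
have -> : C^T *m K^T *m Rm *m K *m C = C^T *m (r *: (K^T *m K)) *m C.
  by rewrite -!mulmxA -!scalemxAl -!scalemxAr mul1mx -!mulmxA.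
rewrite tr_row_mx trmx0 trmx1 -mulmxA mul_mx_row mulmx0 mulmx1 mul_col_row.
rewrite !mul0mx !mulmx0 mul1mx add_block_mx opp_block_mx.
by rewrite !addr0 !oppr0.
Qed.

Lemma lyapunov_lhs K P1 P0 P3 P2 (Acl := A - B *m K *m C)
  (P := block_mx P1 P0 P3 P2 : 'M[R]_(n + n)) :
  Acl^T *m P + P *m Acl =
  block_mx (- (L^-1 *: (P3 + P0))) (P1 - L^-1 *: P2 - P0 *m K)
    (P1 - L^-1 *: P2 - K^T *m P3) (P0 + P3 - (K^T *m P2 + P2 *m K)).
Proof.
rewrite /Acl /P closed_loop tr_block_mx !mulmx_block add_block_mx.
have -> : (- (L^-1 *: 1%:M : 'M[R]_n))^T = - (L^-1 *: 1%:M).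
  by rewrite linearN linearZ /= trmx1.
rewrite [(- K)^T]linearN /= trmx0 trmx1 !mul0mx !mulmx0 !mul1mx !mulmx1.
rewrite !mulNmx !mulmxN -!scalemxAl -!scalemxAr !mul1mx !mulmx1 !add0r.
congr block_mx.
- by rewrite scalerDr opprD.
- by rewrite addrCA addrA.
- by rewrite addrAC.
- by rewrite opprD addrACA.
Qed.

Lemma costI_block K P1 P0 P3 P2 :
  costI B gamma W (K, block_mx P1 P0 P3 P2) =
  \tr P2 + gamma * l1norm (hadamard W K).
Proof.
rewrite /costI tr_col_mx trmx0 trmx1 mul_block_col !mulmx0 !mulmx1 !add0r.
by rewrite mul_col_row !mulmx0 !mulmx1 mxtrace_block mxtrace0 add0r.
Qed.

Lemma profile_le_costI K P : feasibleI A B C Q Rm (K, P) ->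
  laplacians K /\ profile K <= costI B gamma W (K, P).
Proof.
rewrite -[P]submxK costI_block => -[]; rewrite lyapunov_lhs lyapunov_rhs.
move=> /eq_block_mx[/eqP e11 _ _ e22] LK pP; split=> //.
have sK : K^T = K by case: LK => <-.
(* The upper-left block makes the off-diagonal blocks of [P] cancel, so the lower-right block
   becomes a Lyapunov equation in [K] and the last block of [P]. *)
move: e11; rewrite oppr_eq0 scaler_eq0 invr_eq0 (gt_eqF L_gt0) /= addrC.
move=> /eqP e11.
move: e22; rewrite e11 sK sub0r => /oppr_inj /(lapl_trace_lyapunov n_gt0 LK) tP.
rewrite lerD2r tP lerDl mulr_ge0 ?invr_ge0//.
by case: (psd_block_dr pP).
Qed.

(** The solution [S] of the equation with [G] in place of [K] kills [ones]; hence it also solves the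
    equation with [K], and the surplus term in its trace vanishes. *)
Lemma costI_attains K : laplacians K ->
  exists2 P, feasibleI A B C Q Rm (K, P) & costI B gamma W (K, P) = profile K.
Proof.
move=> LK; have [/esym sK K1 pG _] := LK.
have pF : psdmx (Q2 + r *: (K *m K)).
  split=> [|x]; first by rewrite raddfD /= linearZ /= trmx_mul Q2_sym sK.
  rewrite qformDl qformZl addr_ge0//; first by case: Q2_psd.
  by rewrite mulr_ge0 ?(ltW r_gt0)//; case: (psd_sqr sK).
have [S pS SF] := lyapunov_psd pG pF.
have G1 : (K + J) *m ones = ones by rewrite mulmxDl K1 add0r J_ones.
(* Applying the equation to [ones] gives [G *m v = - v] for [v = S *m ones], which a psd [G] allows
   only for [v = 0]. *)
have S1 : S *m ones = 0.
  have : (K + J) *m (S *m ones) + S *m ones = 0.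
    have := congr1 (fun X => X *m ones) SF.
    rewrite mulmxDl -(mulmxA _ S) -(mulmxA S) G1 => ->.
    by rewrite mulmxDl Q2_ones -scalemxAl -mulmxA K1 mulmx0 scaler0 addr0.
  set v := S *m ones => Gv; apply: dot_eq0; apply/eqP.
  rewrite eq_le dot_ge0 andbT.
  have := (pd_psd pG).2 v; rewrite /qform -mulmxA.
  have -> : (K + J) *m v = - v by apply/eqP; rewrite -addr_eq0; apply/eqP.
  by rewrite mulmxN mxE oppr_ge0.
have SJ : S *m J = 0 by rewrite -scalemxAr mulmxA S1 mul0mx scaler0.
have JS : J *m S = 0.
  by have := congr1 trmx SJ; rewrite trmx_mul trmx0 tr_J pS.1.
have KS : K *m S + S *m K = Q2 + r *: (K *m K).
  by rewrite -SF mulmxDl mulmxDr SJ JS !addr0.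
(* With zero off-diagonal blocks, the mixed blocks of the equation dictate the factor [L^-1]. *)
exists (block_mx (L^-1 *: S) 0 0 S).
  split=> //; last first.
    apply: psd_block_diag => //; split=> [|x]; first by rewrite linearZ /= pS.1.
    by rewrite qformZl mulr_ge0 ?invr_ge0 ?(ltW L_gt0)//; case: pS.
  rewrite lyapunov_lhs lyapunov_rhs sK KS !addr0 sub0r scaler0 oppr0 subrr.
  by rewrite mul0mx mulmx0 subr0.
rewrite costI_block (lapl_trace_lyapunov n_gt0 LK KS) /qform -mulmxA S1.
by rewrite mulmx0 mxE mulr0 addr0.
Qed.

Lemma mxtrace_ones (Y : 'M[R]_n) :
  \tr (ones *m ones^T *m Y) = \sum_i \sum_j Y i j.
Proof.
rewrite -mulmxA mxtrace_mulC trace_mx11 exchange_big mxE /=.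
apply: eq_bigr => i _.
by rewrite !mxE mulr1; apply: eq_bigr => j _; rewrite !mxE mul1r.
Qed.

Lemma costIIE (K X Y : 'M[R]_n) : \tr X = \tr (invmx (K + J) *m Q2) ->
  \sum_i \sum_j Y i j = l1norm (hadamard W K) ->
  costII r gamma (K, X, Y) = profile K.
Proof.
by move=> tX sY; rewrite /costII /profile mxtraceD mxtraceZ mxtrace_ones tX sY.
Qed.

(** Definiteness of [G] is the real content. If [G *m v = 0], the block form vanishes at
    [col_mx 0 v], so the square root of [Q2] kills [v]; then [v] lies on the line of [ones], where
    [G] is the identity. *)
Lemma feasibleII_laplacian (K X Y : 'M[R]_n) :
  feasibleII Q2 W (K, X, Y) -> laplacians K.
Proof.
move=> [[sK _ _] [pH MK K1 _ _]]; split=> // [|i j ij]; last first.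
  have := MK i j; rewrite !mxE big_ord1 !mxE (negPf ij) mulr1 subr0.
  by rewrite mul1r.
have [[sS _] SS] := psd_sqrtP Q2_psd.
apply: psd_pd (psd_block_dr pH) _ => v Gv.
have : psd_sqrt Q2 *m v = 0.
  have := psd_ker (x := col_mx 0 v) pH.
  rewrite /qform tr_col_mx -mulmxA mul_block_col !mulmx0 !add0r Gv.
  rewrite mul_row_col trmx0 mul0mx mulmx0 addr0 mxE => /(_ erefl).
  by rewrite -col_mx0 => /eq_col_mx[].
move=> Sv; have /Q2_ker Jv : qform Q2 v = 0.
  by rewrite /qform -SS -!mulmxA Sv !mulmx0 mxE.
by rewrite -Jv -(lapl_mulJ n_gt0 K1) -mulmxA Jv Gv.
Qed.

Lemma profile_le_costII (K X Y : 'M[R]_n) : feasibleII Q2 W (K, X, Y) ->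
  laplacians K /\ profile K <= costII r gamma (K, X, Y).
Proof.
move=> fK; have LK := feasibleII_laplacian fK; split=> //.
have [_ _ pG _] := LK; have uG := pd_unit pG; have [sG _] := pG.
have [[sS _] SS] := psd_sqrtP Q2_psd.
case: fK => [[_ _ _] [pH _ _ YW WY]].
have YL : l1norm (hadamard W K) <= \sum_i \sum_j Y i j.
  apply: ler_sum => i _; apply: ler_sum => j _.
  by rewrite ler_norml WY andbT; have := YW i j; rewrite mxE.
have tX : \tr (invmx (K + J) *m Q2) <= \tr X.
  (* Congruence by [T] extracts the Schur complement of [G], whose trace is therefore
     nonnegative. *)
  pose T := col_mx 1%:M (- (invmx (K + J) *m psd_sqrt Q2)) : 'M[R]_(n + n, n).
  have : 0 <= \tr (T^T *m block_mx X (psd_sqrt Q2) (psd_sqrt Q2) (K + J) *m T).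
    by rewrite mxtrace_qform sumr_ge0// => i _; case: pH.
  rewrite -mulmxA mul_block_col !mulmx1 !mulmxN mulKVmx// subrr tr_col_mx.
  rewrite mul_row_col mulmx0 addr0 trmx1 mul1mx mulmxA raddfB /= subr_ge0.
  by rewrite mxtrace_mulC mulmxA SS mxtrace_mulC.
rewrite /costII /profile mxtraceD mxtraceZ mxtrace_ones lerD//.
  by rewrite ler_pM2l ?invr_gt0 ?ltr0n// lerD2r.
exact: ler_wpM2l.
Qed.

Lemma costII_attains K : laplacians K ->
  exists X Y, feasibleII Q2 W (K, X, Y) /\ costII r gamma (K, X, Y) = profile K.
Proof.
move=> LK; have [/esym sK K1 pG K0] := LK.
have uG := pd_unit pG; have [sG _] := pG.
have [[sS _] SS] := psd_sqrtP Q2_psd.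
set S := psd_sqrt Q2 in sS SS.
(* This [X] makes the Schur complement zero, and this [Y] is the least one allowed by the entrywise
   bounds. *)
exists (S *m invmx (K + J) *m S), (\matrix_(i, j) `|hadamard W K i j|).
split; last first.
  apply: costIIE; first by rewrite mxtrace_mulC mulmxA SS mxtrace_mulC.
  by apply: eq_bigr => i _; apply: eq_bigr => j _; rewrite mxE.
split; split=> //.
- by rewrite !trmx_mul sS (lapl_inv_sym LK) mulmxA.
- by move=> i j; rewrite !mxE.
(* With zero Schur complement the block matrix is a congruence of [G] alone. *)
- pose T := row_mx (invmx (K + J) *m S) 1%:M : 'M[R]_(n, n + n).
  rewrite -/S; have -> : block_mx (S *m invmx (K + J) *m S) S S (K + J) =
      T^T *m (K + J) *m T.
    rewrite -[RHS]mulmxA mul_mx_row tr_row_mx mul_col_row mulKVmx// trmx1.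
    rewrite !mul1mx mulmx1.
    by rewrite trmx_mul sS (lapl_inv_sym LK) mulmxKV// mulmxA.
  exact/psd_congr/pd_psd.
- move=> i j; rewrite !mxE big_ord1 !mxE mulr1.
  have [->|ij] := eqVneq i j; first by rewrite subrr mul0r.
  by rewrite subr0 mul1r K0.
- by move=> i j; rewrite !mxE lerNl -normrN ler_norm.
- by move=> i j; rewrite !mxE ler_norm.
Qed.

End Problems.

(** * Comparison of the two problems through [profile] *)

Theorem proposition2 (R : realType) (n : nat) (hn : (1 <= n)%N)
  (L r gamma : R) (hL : 0 < L) (hr : 0 < r) (hgamma : 0 <= gamma)
  (W Q2 : 'M[R]_n)
  (hQ2sym : Q2^T = Q2) (hQ2ones : Q2 *m ones = 0 :> 'cV[R]_n)
  (hQ2pos : forall z : 'cV[R]_n,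
     z != 0 -> z^T *m ones = 0 :> 'M[R]_1 -> 0 < qform Q2 z) :
  let A : 'M[R]_(n + n) := block_mx 0 1%:M (- (L^-1 *: 1%:M)) 0 in
  let B : 'M[R]_(n + n, n) := col_mx 0 1%:M in
  let C : 'M[R]_(n, n + n) := row_mx 0 1%:M in
  let Q : 'M[R]_(n + n) := block_mx 0 0 0 Q2 in
  let Rm : 'M[R]_n := r *: 1%:M in
  forall K : 'M[R]_n,
    (exists P : 'M[R]_(n + n),
       minimizer (feasibleI A B C Q Rm) (costI B gamma W) (K, P))
    <->
    (exists X Y : 'M[R]_n,
       minimizer (feasibleII Q2 W) (costII r gamma) (K, X, Y)).
Proof.
move=> A B C Q Rm K.
pose lapl : set 'M[R]_n := @laplacians R n.
have optI : (exists2 u, u.1 = K &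
    minimizer (feasibleI A B C Q Rm) (costI B gamma W) u) <->
    minimizer lapl (profile r gamma W Q2) K.
  apply: minimizer_proj => [[K' P] fP|K' LK].
    exact: (profile_le_costI hn gamma W hL fP).
  have [P fP cP] := costI_attains hn gamma W hL hr hQ2sym hQ2ones hQ2pos LK.
  by exists (K', P).
have optII : (exists2 u, u.1.1 = K &
    minimizer (feasibleII Q2 W) (costII r gamma) u) <->
    minimizer lapl (profile r gamma W Q2) K.
  apply: (minimizer_proj (pr := fun u => u.1.1)) => [[[K' X] Y] fXY|K' LK].
    exact: (profile_le_costII hn r hgamma hQ2sym hQ2ones hQ2pos fXY).
  have [X [Y [f c]]] :=
    costII_attains hn r gamma W hQ2sym hQ2ones hQ2pos LK.
  by exists (K', X, Y).
split=> [[P mP]|[X [Y mXY]]].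
  have /optII[[[_ X] Y] /= ->] : minimizer lapl (profile r gamma W Q2) K.
    by apply/optI; exists (K, P).
  by exists X, Y.
have /optI[[_ P] /= ->] : minimizer lapl (profile r gamma W Q2) K.
  by apply/optII; exists (K, X, Y).
by exists P.
Qed.
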